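(* The competitive ratio of the Move-All-Equally algorithm for $r$-uniform Online Min-Sum Set Cover against the dynamic optimum is $O(r^{3/2}\sqrt{n})$; that is, there is an absolute constant $C$ such that for all $n$ and $r$, Move-All-Equally is $C\,r^{3/2}\sqrt{n}$-competitive against the dynamic optimum.
   Context: Let $U$ be a set of $n$ elements; a permutation $\pi$ of $U$ gives each element $e$ a position $\pi[e]\in\{1,\dots,n\}$, and $\pi(S)=\min_{e\in S}\pi[e]$ for nonempty $S\subseteq U$. $d_{KT}(\pi,\sigma)$ is the number of pairs of elements ordered differently by $\pi,\sigma$. In $r$-uniform Online Min-Sum Set Cover, from an initial permutation $\pi_0$, request sets $S_1,\dots,S_m$ with $|S_t|=r$ arrive online; on arrival of $S_t$ an algorithm holding $\pi_{t-1}$ pays access cost $\pi_{t-1}(S_t)$ and then moves to $\pi_t$ paying $d_{KT}(\pi_{t-1},\pi_t)$. The dynamic optimum is $\mathrm{OPT}_{dyn}=\min\sum_{t=1}^m\big(\pi^*_t(S_t)+d_{KT}(\pi^*_{t-1},\pi^*_t)\big)$ over all sequences of permutations $\pi^*_1,\dots,\pi^*_m$, with $\pi^*_0=\pi_0$. An algorithm is $c$-competitive against the dynamic optimum if its cost is at most $c\cdot\mathrm{OPT}_{dyn}+\alpha$ for all initial permutations and sequences, with $\alpha$ independent of the sequence. Move-All-Equally: given current permutation $\pi$ and request $S$, let $k=\pi(S)$; the new permutation $\pi'$ places each $e\in S$ at $\pi'[e]=\pi[e]-(k-1)$ and the elements of $U\setminus S$ fill the remaining positions in their relative order in $\pi$.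 *)

(* Defs.v *)
From mathcomp Require Import all_boot all_order all_algebra.
From mathcomp Require Import reals.
Set Implicit Arguments.
Unset Strict Implicit.
Unset Printing Implicit Defensive.

(* A permutation of U assigns distinct positions to the elements of U.        *)
(* Internally positions are 0-based; [pos] below is the 1-based position.     *)
Definition ordering (U : finType) :=
  {f : {ffun U -> 'I_#|U|} | injectiveb f}.

Section OnlineMinSumSetCover.

Variable U : finType.
Implicit Types (pi sigma : ordering U) (S : {set U}) (Ss : seq {set U}).

Definition pos pi (e : U) : nat := (val pi e : nat).+1.

(* All positions are at most #|U|, so the neutral element #|U| does not       *)
(* affect the minimum over a nonempty S.                                      *)
Definition minpos pi S : nat := \big[minn/#|U|]_(e in S) pos pi e.

(* Each discordant unordered pair is counted once, oriented as in pi.         *)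
Definition dKT pi sigma : nat :=
  #|[set ef : U * U | (pos pi ef.1 < pos pi ef.2)
                      && (pos sigma ef.2 < pos sigma ef.1)]|.

(* The permutations pi_1, ..., pi_m are the items of ps, so that              *)
(* nth pi0 (pi0 :: ps) t is pi_t. Requests are 0-based: S_(t+1) = Ss`_t.      *)
Definition dyn_cost (pi0 : ordering U) Ss (ps : seq (ordering U)) : nat :=
  \sum_(t < size Ss)
     (minpos (nth pi0 (pi0 :: ps) t.+1) (nth set0 Ss t)
      + dKT (nth pi0 (pi0 :: ps) t) (nth pi0 (pi0 :: ps) t.+1)).

Definition opt_dyn (pi0 : ordering U) Ss : nat :=
  dyn_cost pi0 Ss
    [arg min_(ps < [tuple of nseq (size Ss) pi0]) dyn_cost pi0 Ss ps].

(* An online algorithm whose only memory is its current permutation: it maps  *)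
(* pi_(t-1) and S_t to pi_t. In contrast to [dyn_cost], the access cost is    *)
(* paid before moving.                                                        *)
Definition alg_cost (A : ordering U -> {set U} -> ordering U)
    (pi0 : ordering U) Ss : nat :=
  let ps := pi0 :: scanl A pi0 Ss in
  \sum_(t < size Ss)
     (minpos (nth pi0 ps t) (nth set0 Ss t)
      + dKT (nth pi0 ps t) (nth pi0 ps t.+1)).

Definition competitive_dyn (R : realType) (r : nat)
    (A : ordering U -> {set U} -> ordering U) (c : R) : Prop :=
  exists alpha : R, forall (pi0 : ordering U) Ss,
    {in Ss, forall S, #|S| = r} ->
    ((alg_cost A pi0 Ss)%:R <= c * (opt_dyn pi0 Ss)%:R + alpha)%R.

Definition mae_spec pi S pi' : bool :=
  [forall e in S, pos pi' e == pos pi e - (minpos pi S - 1)]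
  && [forall e in ~: S, forall f in ~: S,
        (pos pi' e < pos pi' f) == (pos pi e < pos pi f)].

(* For nonempty S, exactly one permutation satisfies [mae_spec pi S]: see     *)
(* [move_all_equallyP] and [mae_spec_inj].                                    *)
Definition move_all_equally pi S : ordering U :=
  odflt pi [pick pi' | mae_spec pi S pi'].

Lemma pos_inj pi : injective (pos pi).
Proof.
move=> e f [] /val_inj; apply: (injectiveP _ (valP pi)).
Qed.

Lemma minpos_le pi S e : e \in S -> minpos pi S <= pos pi e.
Proof.
move=> eS; rewrite /minpos; have := mem_index_enum e.
elim: (index_enum U) => // f s IHs; rewrite inE big_cons.
case/predU1P=> [<-|/IHs le_e]; first by rewrite eS geq_minl.
by case: ifP => // _; apply: leq_trans (geq_minr _ _) le_e.
Qed.

Lemma minpos_gt0 pi S : 0 < #|S| -> 0 < minpos pi S.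
Proof.
move=> /card_gt0P[e eS]; rewrite /minpos; elim/big_ind: _ => //.
- by apply/card_gt0P; exists e.
- by move=> x y x0 y0; rewrite leq_min x0.
Qed.

Lemma mae_spec_ex pi S : 0 < #|S| -> exists pi', mae_spec pi S pi'.
Proof.
move=> S0; have k0 := minpos_gt0 pi S0; set k := minpos pi S in k0.
have gP e : val pi e - (k - 1) < #|U|.
  by apply: leq_ltn_trans (ltn_ord (val pi e)); apply: leq_subr.
pose g e := Ordinal (gP e).
have g_inj : {in S &, injective g}.
  move=> e f eS fS /(congr1 val) /= E.
  have := minpos_le pi eS; have := minpos_le pi fS; rewrite -/k /pos => kf ke.
  apply: (@pos_inj pi); rewrite /pos; congr _.+1.
  have {}ke : k - 1 <= val pi e by rewrite leq_subLR add1n.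
  have {}kf : k - 1 <= val pi f by rewrite leq_subLR add1n.
  by rewrite -(subnK ke) -(subnK kf) E.
pose F := ~: (g @: S).
have cF : #|F| = #|~: S|.
  have := cardsC (g @: S); rewrite card_in_imset // card_ord => E.
  by apply: (@addnI #|S|); rewrite cardsC.
pose rk e := #|[set f in ~: S | pos pi f < pos pi e]|.
have rk_lt e : e \in ~: S -> rk e < #|F|.
  move=> eS; rewrite cF; apply: proper_card; apply/properP; split.
    by apply/subsetP=> f; rewrite inE => /andP[].
  by exists e => //; rewrite inE ltnn andbF.
have rk_mono e f : e \in ~: S -> pos pi e < pos pi f -> rk e < rk f.
  move=> eS ef; apply: proper_card; apply/properP; split.
    by apply/subsetP=> h; rewrite !inE => /andP[-> /ltn_trans->].
  by exists e; rewrite !inE ?ltnn ?andbF //; rewrite inE in eS; rewrite eS.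
pose h e := if e \in S then g e else nth (g e) (enum F) (rk e).
have hF e : e \in ~: S -> h e \in F.
  move=> eS; rewrite /h; move: (eS); rewrite inE => /negbTE->.
  by rewrite -mem_enum mem_nth // -cardE rk_lt.
have sF : sorted ltn (map val (enum F)).
  have -> : enum F = filter (mem F) (enum 'I_#|U|) by rewrite enumT.
  rewrite sorted_map; apply: sorted_filter; first by move=> x y z; apply: ltn_trans.
  by rewrite -sorted_map val_enum_ord iota_ltn_sorted.
have h_mono e f : e \in ~: S -> f \in ~: S -> pos pi e < pos pi f -> h e < h f.
  move=> eS fS ef; rewrite /h; have := eS; have := fS.
  rewrite !inE => /negbTE-> /negbTE->.
  have re := rk_lt _ eS; have rf := rk_lt _ fS; rewrite cardE in re rf.
  rewrite (set_nth_default (g e) (g f) rf).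
  rewrite -!(nth_map (g e) 0 val) //.
  by apply: (sorted_ltn_nth ltn_trans 0 sF); rewrite ?inE ?size_map // rk_mono.
have h_inj : injective h.
  move=> e f; case: (boolP (e \in S)) => eS; case: (boolP (f \in S)) => fS E.
  - by apply: g_inj => //; move: E; rewrite /h eS fS.
  - have := hF f; rewrite !inE fS -E /h eS imset_f // => /(_ isT) //.
  - have := hF e; rewrite !inE eS E /h fS imset_f // => /(_ isT) //.
  - case: (ltngtP (pos pi e) (pos pi f)) => [ef|fe|/pos_inj //].
    + by have := h_mono e f; rewrite !inE eS fS E ltnn => /(_ isT isT ef).
    + by have := h_mono f e; rewrite !inE eS fS E ltnn => /(_ isT isT fe).
have hP : injectiveb (finfun h) by apply/injectiveP=> e f; rewrite !ffunE => /h_inj.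
exists (exist _ (finfun h) hP : ordering U); apply/andP; split.
  apply/forall_inP=> e eS; rewrite /pos /= ffunE /h eS /=.
  by rewrite -/k subSn // leq_subLR add1n; apply: minpos_le.
apply/forall_inP=> e eS; apply/forall_inP=> f fS; apply/eqP.
rewrite {1 2}/pos /= !ffunE ltnS.
case: (ltngtP (pos pi e) (pos pi f)) => [ef|fe|/pos_inj ->]; last by rewrite ltnn.
- exact: h_mono.
- by apply/negbTE; rewrite -leqNgt ltnW // h_mono.
Qed.

Lemma move_all_equallyP pi S :
  0 < #|S| -> mae_spec pi S (move_all_equally pi S).
Proof.
move=> /(mae_spec_ex pi)[pi' spec]; rewrite /move_all_equally.
by case: pickP => [//|/(_ pi')]; rewrite spec.
Qed.

Lemma mae_spec_inj pi S pi1 pi2 :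
  mae_spec pi S pi1 -> mae_spec pi S pi2 -> pi1 = pi2.
Proof.
move=> /andP[/forall_inP P1 /forall_inP M1] /andP[/forall_inP P2 /forall_inP M2].
pose F pi' := [set val pi' e | e in ~: S].
have val_inj_ pi' : injective (val pi') by apply/injectiveP; apply: (valP pi').
have valS e : e \in S -> val pi1 e = val pi2 e.
  move=> eS; apply: val_inj; apply: succn_inj.
  by rewrite -/(pos pi1 e) -/(pos pi2 e) (eqP (P1 e eS)) (eqP (P2 e eS)).
have FC pi' : F pi' = ~: [set val pi' e | e in S].
  apply/eqP; rewrite eqEcard; apply/andP; split.
    apply/subsetP=> _ /imsetP[e eS ->]; rewrite !inE in eS *.
    by rewrite mem_imset.
  have := cardsC [set val pi' e | e in S]; rewrite !card_imset // card_ord.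
  by move=> E; rewrite -(leq_add2l #|S|) E cardsC.
have eqF : F pi1 = F pi2.
  by rewrite !FC; congr (~: _); apply: eq_in_imset => e /valS.
pose below (x : 'I_#|U|) := [set y in F pi1 | y < x].
have cb pi' e : mae_spec pi S pi' -> F pi' = F pi1 -> e \in ~: S ->
    #|below (val pi' e)| = #|[set f in ~: S | pos pi f < pos pi e]|.
  move=> /andP[_ /forall_inP M] EF eS; rewrite -(card_imset _ (val_inj_ pi')).
  congr #|pred_of_set _|; apply/setP=> x; rewrite inE -EF.
  have ltE f : f \in ~: S -> (val pi' f < val pi' e) = (pos pi f < pos pi e).
    by move=> fS; have /forall_inP/(_ e eS)/eqP <- := M f fS.
  apply/andP/imsetP => [[/imsetP[f fS ->] lt_fe]|[f]].
    by exists f => //; rewrite inE fS -ltE.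
  by rewrite inE => /andP[fS lt_fe] ->; rewrite imset_f // ltE.
have lt_below (x y : 'I_#|U|) : x \in F pi1 -> x < y -> #|below x| < #|below y|.
  move=> xF xy; apply: proper_card; apply/properP; split.
    by apply/subsetP=> z; rewrite !inE => /andP[-> /ltn_trans->].
  by exists x; rewrite !inE ?xF // ltnn.
apply: val_inj; apply/ffunP=> e; case: (boolP (e \in S)) => [/valS //|eS].
have {}eS : e \in ~: S by rewrite inE.
have S1 : mae_spec pi S pi1 by apply/andP; split; apply/forall_inP.
have S2 : mae_spec pi S pi2 by apply/andP; split; apply/forall_inP.
have := cb pi1 e S1 erefl eS; rewrite -(cb pi2 e S2 (esym eqF) eS) => E.
have F1 : val pi1 e \in F pi1 by apply: imset_f.
have F2 : val pi2 e \in F pi1 by rewrite eqF; apply: imset_f.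
apply: val_inj; case: (ltngtP (val pi1 e) (val pi2 e)) => // lt12.
  by have := lt_below _ _ F1 lt12; rewrite E ltnn.
by have := lt_below _ _ F2 lt12; rewrite E ltnn.
Qed.

End OnlineMinSumSetCover.

(* Main.v *)
(* Fix J of order sqrt (n / r) and give each element e the weight             *)
(* max(0, 2J - pos sigma e), where sigma is the permutation held by the       *)
(* optimum. The potential is the weighted sum of the positions held by        *)
(* Move-All-Equally. A swap of the optimum raises it by at most n. When       *)
(* Move-All-Equally accesses S at depth k, every element falls back by at     *)
(* most r, which costs at most 4 J^2 r since the weights add up to at most    *)
(* 4 J^2; if the optimum serves S at depth at most J, the element it uses     *)
(* has weight at least J and advances by k - 1; otherwise the optimum itself  *)
(* pays more than J for an access that costs Move-All-Equally at most n.      *)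
(* Thus J k <= (J + 4 J^2 r + n) (cost of the optimum) - (potential growth),  *)
(* and since J^2 r is of order n, dividing by J leaves a factor of order      *)
(* sqrt (r n). Reordering costs Move-All-Equally at most r k, whence the last *)
(* factor r.                                                                  *)
Require Import Defs.
From mathcomp Require Import all_boot all_order all_algebra.
From mathcomp Require Import reals exp.
From mathcomp Require Import zify lra.
Set Implicit Arguments.
Unset Strict Implicit.
Unset Printing Implicit Defensive.
Import Order.TTheory GRing.Theory Num.Theory.

(** The growth of the potential in one request splits into the optimum's move ([potential_dKT]) and
    the move of Move-All-Equally ([potential_mae], [potential_mae_near]); [potential_step] combines
    them. Summed over the requests the potential telescopes ([mae_cost_le]), and [mae_dKT_le]
    extends the bound from access to total cost. Changes of position are bounded by comparing sets
    of predecessors ([card_before]). *)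

Section Orderings.

Variable U : finType.
Implicit Types (pi sigma tau : ordering U) (S : {set U}) (e f : U).

(** * Positions and inversions *)

Lemma pos_le_card pi e : pos pi e <= #|U|.
Proof. exact: ltn_ord. Qed.

Lemma minpos_le_card pi S : minpos pi S <= #|U|.
Proof.
by rewrite /minpos; elim/big_rec: _ => // e m _; apply/leq_trans/geq_minr.
Qed.

Lemma minpos_attained pi S :
  0 < #|S| -> exists2 e, e \in S & pos pi e = minpos pi S.
Proof.
move=> /card_gt0P[e0 e0S].
case: (arg_minnP (fun e => pos pi e) e0S) => e eS min_e; exists e => //.
apply/eqP; rewrite eqn_leq minpos_le // andbT.
rewrite /minpos; elim/big_ind: _ => //; first exact: pos_le_card.
by move=> x y ex ey; rewrite leq_min ex.
Qed.

Lemma card_pos_le pi m : m <= #|U| -> #|[set f | pos pi f <= m]| = m.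
Proof.
move=> le_mU; have inj : injective (val pi) by apply/injectiveP/(valP pi).
have [g gK Kg] : bijective (val pi) by apply: inj_card_bij; rewrite ?card_ord.
rewrite -[RHS]card_ord -(card_imset _ inj).
have wid_inj : injective (widen_ord le_mU) by move=> i j [/val_inj].
rewrite -[RHS](card_codom wid_inj).
apply: eq_card => x; apply/imsetP/codomP => [[f]|[i ->]].
  by rewrite inE => lt_f ->; exists (Ordinal lt_f); apply: val_inj.
by exists (g (widen_ord le_mU i)); rewrite ?inE /pos Kg //=.
Qed.

Lemma card_pos_le_leq pi m : #|[set f | pos pi f <= m]| <= m.
Proof.
have [/(card_pos_le pi) ->|/ltnW] := leqP m #|U|; first by [].
by apply: leq_trans; apply: max_card.
Qed.

Lemma card_before pi e : #|[set f | pos pi f < pos pi e]| = (pos pi e).-1.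
Proof.
rewrite -[RHS](card_pos_le pi) ?(leq_trans (leq_pred _) (pos_le_card pi e)) //.
Qed.

(** Charges each inversion to the element that moves ahead. *)
Definition overtaken_by sigma tau f :=
  [set e | (pos sigma e < pos sigma f) && (pos tau f < pos tau e)].

Lemma dKT_sum sigma tau : dKT sigma tau = \sum_f #|overtaken_by sigma tau f|.
Proof.
rewrite /dKT -sum1dep_card -(pair_big_dep xpredT
  (fun e f => (pos sigma e < pos sigma f) && (pos tau f < pos tau e))
  (fun _ _ => 1)) (exchange_big_dep xpredT) //=.
by apply: eq_bigr => f _; rewrite sum1dep_card.
Qed.

(** A predecessor of [f] in [sigma] either remains one in [tau] or is overtaken. *)
Lemma pos_le_overtaken sigma tau f :
  pos sigma f <= pos tau f + #|overtaken_by sigma tau f|.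
Proof.
suff: #|[set e | pos sigma e < pos sigma f]| <=
      #|[set e | pos tau e < pos tau f]| + #|overtaken_by sigma tau f|.
  by rewrite !card_before /pos; lia.
apply: leq_trans (leq_card_setU _ _); apply/subset_leq_card/subsetP => e.
rewrite !inE => lt_ef; rewrite lt_ef /=.
by case: ltngtP => // /pos_inj ef; rewrite ef ltnn in lt_ef.
Qed.

(** * One step of Move-All-Equally *)

Section MoveAllEqually.

Variables (pi : ordering U) (S : {set U}).
Hypothesis S_gt0 : 0 < #|S|.
Let pi' := move_all_equally pi S.

Lemma mae_pos_in e : e \in S -> pos pi' e = pos pi e - (minpos pi S - 1).
Proof.
by have /andP[/forall_inP in_S _] := move_all_equallyP pi S_gt0 => /in_S/eqP.
Qed.

Lemma mae_pos_notin e f : e \notin S -> f \notin S ->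
  (pos pi' e < pos pi' f) = (pos pi e < pos pi f).
Proof.
have /andP[_ /forall_inP out_S] := move_all_equallyP pi S_gt0 => eS fS.
have /forall_inP/(_ f) := out_S e ltac:(by rewrite inE).
by rewrite inE => /(_ fS)/eqP.
Qed.

Lemma mae_ltn_in e f : e \in S -> f \in S ->
  (pos pi' e < pos pi' f) = (pos pi e < pos pi f).
Proof.
move=> eS fS; rewrite !mae_pos_in //.
by have := minpos_le pi eS; have := minpos_le pi fS; rewrite /pos; lia.
Qed.

(** The order outside [S] is kept, so only members of [S] can become new predecessors. *)
Lemma mae_pos_le e : pos pi' e <= pos pi e + #|S|.
Proof.
have [eS|eS] := boolP (e \in S); first by rewrite mae_pos_in //; lia.
suff: #|[set f | pos pi' f < pos pi' e]| <= #|[set f | pos pi f < pos pi e]| + #|S|.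
  by rewrite !card_before /pos; lia.
apply: leq_trans (leq_card_setU _ _); apply/subset_leq_card/subsetP => f.
rewrite !inE; have [_|fS] := boolP (f \in S); first by rewrite orbT.
by rewrite mae_pos_notin // orbF.
Qed.

Let before (sigma : ordering U) e := [set f in ~: S | pos sigma f < pos sigma e].

(** The order within [S] is kept, so the positions that [e] gains are all at the expense of elements
    outside [S]. *)
Lemma mae_card_before e : e \in S ->
  #|before pi' e| + (minpos pi S - 1) = #|before pi e|.
Proof.
move=> eS; have split_before sigma : (pos sigma e).-1 =
    #|[set f in S | pos sigma f < pos sigma e]| + #|before sigma e|.
  rewrite -card_before -(cardsID S); congr (_ + _);
  by apply: eq_card => f; rewrite !inE // andbC.
have := split_before pi; have := split_before pi'.
have -> : [set f in S | pos pi' f < pos pi' e] =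
          [set f in S | pos pi f < pos pi e].
  by apply/setP => f; rewrite !inE; case: (boolP (f \in S)) => //= /mae_ltn_in->.
have := mae_pos_in eS; have := minpos_le pi eS; have := minpos_gt0 pi S_gt0.
by rewrite /pos; lia.
Qed.

(* Both sets are initial segments of the complement of S, whose order does    *)
(* not change, so they are comparable and their sizes decide.                 *)
Lemma mae_before_sub e : e \in S -> before pi' e \subset before pi e.
Proof.
move=> eS; apply/subsetP => f fB; have := fB; rewrite !inE => /andP[fS lt_fe].
rewrite fS /= ltnNge; apply/negP => le_ef.
suff: #|before pi e| < #|before pi' e| by rewrite -mae_card_before //; lia.
apply: proper_card; apply/properP; split; last first.
  by exists f => //; rewrite !inE fS -leqNgt.
apply/subsetP => g; rewrite !inE => /andP[gS lt_ge]; rewrite gS /=.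
by apply: ltn_trans lt_fe; rewrite mae_pos_notin // (leq_trans lt_ge).
Qed.

(** Only members of [S] overtake, and each overtakes at most [minpos pi S - 1] elements, all outside
    [S]. *)
Lemma mae_dKT_le : dKT pi pi' <= #|S| * minpos pi S.
Proof.
rewrite dKT_sum -sum_nat_const [leqRHS]big_mkcond; apply: leq_sum => f _.
case: ifP => fS.
  rewrite (@leq_trans #|before pi f :\: before pi' f|) //; last first.
    rewrite cardsD (setIidPr (mae_before_sub fS)) -mae_card_before //; lia.
  apply/subset_leq_card/subsetP => e; rewrite !inE => /andP[lt_ef lt_fe'].
  have -> /= : e \notin S.
    by apply/negP => eS; move: lt_fe'; rewrite mae_ltn_in // ltnNge ltnW.
  by rewrite lt_ef -leqNgt ltnW.
rewrite leqn0 cards_eq0; apply/eqP/setP => e; rewrite !inE.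
apply/negP => /andP[lt_ef lt_fe'].
have [eS|eS] := boolP (e \in S); last first.
  by move: lt_fe'; rewrite mae_pos_notin ?fS // ltnNge ltnW.
have /subsetP/(_ f) := mae_before_sub eS.
by rewrite !inE fS lt_fe' /= => /(_ isT); rewrite ltnNge ltnW.
Qed.

End MoveAllEqually.

(** * The potential and its growth in one request *)

Section Potential.

Variable J : nat.

Definition weight sigma e := 2 * J - pos sigma e.

Definition potential pi sigma := \sum_e weight sigma e * pos pi e.

Lemma sum_weight sigma : \sum_e weight sigma e <= 4 * J ^ 2.
Proof.
apply: (@leq_trans (\sum_(e in [set e | pos sigma e <= 2 * J]) 2 * J)).
  rewrite [leqRHS]big_mkcond; apply: leq_sum => e _; rewrite inE /weight.
  by case: (leqP (pos sigma e)); lia.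
rewrite sum_nat_const; have := card_pos_le_leq sigma (2 * J); nia.
Qed.

Lemma potential_le pi sigma : potential pi sigma <= 4 * J ^ 2 * #|U|.
Proof.
apply: (@leq_trans (\sum_e weight sigma e * #|U|)).
  by apply: leq_sum => e _; rewrite leq_mul2l pos_le_card orbT.
by rewrite -big_distrl leq_mul2r sum_weight orbT.
Qed.

(** The weight of [e] grows by at most the number of elements it overtakes, and its position is at
    most [#|U|]. *)
Lemma potential_dKT pi sigma tau :
  potential pi tau <= potential pi sigma + #|U| * dKT sigma tau.
Proof.
rewrite dKT_sum big_distrr -big_split; apply: leq_sum => e _ /=.
have := pos_le_overtaken sigma tau e; have := pos_le_card pi e.
rewrite /weight; set D := #|_|; set p := pos pi e => pU sD.
apply: (@leq_trans ((2 * J - pos sigma e + D) * p)); first by rewrite leq_mul2r; lia.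
by rewrite mulnDl leq_add2l mulnC leq_mul2r pU orbT.
Qed.

Lemma potential_mae pi sigma S : 0 < #|S| ->
  potential (move_all_equally pi S) sigma <= potential pi sigma + 4 * J ^ 2 * #|S|.
Proof.
move=> S_gt0; apply: (@leq_trans (\sum_e weight sigma e * (pos pi e + #|S|))).
  by apply: leq_sum => e _; rewrite leq_mul2l mae_pos_le ?orbT.
under eq_bigr do rewrite mulnDr.
by rewrite big_split leq_add2l -big_distrl leq_mul2r sum_weight orbT.
Qed.

Lemma potential_mae_near pi sigma S : 0 < #|S| -> minpos sigma S <= J ->
  potential (move_all_equally pi S) sigma + J * (minpos pi S - 1)
    <= potential pi sigma + 4 * J ^ 2 * #|S|.
Proof.
move=> S_gt0 near; have [e eS e_min] := minpos_attained sigma S_gt0.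
apply: (@leq_trans (\sum_f weight sigma f * (pos pi f + #|S|))); last first.
  under eq_bigr do rewrite mulnDr.
  by rewrite big_split leq_add2l -big_distrl leq_mul2r sum_weight orbT.
rewrite /potential (bigD1 e) //= [leqRHS](bigD1 e) //= addnAC.
apply: leq_add; last first.
  by apply: leq_sum => f _; rewrite leq_mul2l mae_pos_le ?orbT.
rewrite mae_pos_in //; have := minpos_le pi eS; have := minpos_gt0 pi S_gt0.
have : J <= weight sigma e by rewrite /weight e_min; lia.
move: (weight _ _) (pos _ _) (minpos pi S) => w p k Jw k_gt0 kp.
apply: (@leq_trans (w * (p - (k - 1)) + w * (k - 1))).
  by rewrite leq_add2l leq_mul2r Jw orbT.
by rewrite -mulnDr leq_mul2l; lia.
Qed.

Lemma potential_step pi sigma tau S : 0 < #|S| ->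
  J * minpos pi S + potential (move_all_equally pi S) tau <=
  potential pi sigma
    + (J + 4 * J ^ 2 * #|S| + #|U|) * (minpos tau S + dKT sigma tau).
Proof.
move=> S_gt0; have := potential_dKT pi sigma tau.
have := minpos_gt0 tau S_gt0; have := minpos_le_card pi S.
have := minpos_gt0 pi S_gt0.
(* Near: the summand [J] pays for the 1 in [minpos pi S - 1]. Far:
   [J * minpos pi S <= #|U| * minpos tau S]. *)
have [near|far] := leqP (minpos tau S) J.
  have := potential_mae_near pi S_gt0 near; nia.
have := potential_mae pi tau S_gt0; nia.
Qed.

End Potential.

(** * Summation over the request sequence *)

Lemma dyn_cost_cons pi0 S Ss p ps : size ps = size Ss ->
  dyn_cost pi0 (S :: Ss) (p :: ps) =
  minpos p S + dKT pi0 p + dyn_cost p Ss ps.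
Proof.
move=> sz; rewrite /dyn_cost /= big_ord_recl /=; congr (_ + _).
apply: eq_bigr => i _; have lt_i := ltn_ord i.
by rewrite /= !(set_nth_default p pi0) //= sz; lia.
Qed.

Lemma alg_cost_cons A pi0 S Ss :
  alg_cost A pi0 (S :: Ss) =
  minpos pi0 S + dKT pi0 (A pi0 S) + alg_cost A (A pi0 S) Ss.
Proof.
rewrite /alg_cost /= big_ord_recl /=; congr (_ + _).
apply: eq_bigr => i _; have lt_i := ltn_ord i.
by rewrite /= !(set_nth_default (A pi0 S) pi0) //= size_scanl; lia.
Qed.

Lemma mae_cost_le J r pi0 sigma0 Ss ps : 0 < r ->
    {in Ss, forall S, #|S| = r} -> size ps = size Ss ->
  J * alg_cost (@move_all_equally U) pi0 Ss <=
  2 * r * (potential J pi0 sigma0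
           + (J + 4 * J ^ 2 * r + #|U|) * dyn_cost sigma0 Ss ps).
Proof.
move=> r_gt0; elim: Ss ps pi0 sigma0 => [|S Ss IHs] [|p ps] // pi0 sigma0 Sr.
  by rewrite /alg_cost big_ord0 muln0.
move=> [sz]; have cS : #|S| = r by apply: Sr; rewrite mem_head.
have S_gt0 : 0 < #|S| by rewrite cS.
have {}IHs := IHs ps (move_all_equally pi0 S) p
                (fun T TSs => Sr T (@mem_behead _ (S :: Ss) T TSs)) sz.
have := potential_step J pi0 sigma0 p S_gt0.
have := mae_dKT_le pi0 S_gt0.
rewrite alg_cost_cons dyn_cost_cons // cS; move: IHs.
move: (potential J pi0 _) (potential J _ p) (dyn_cost _ _ _) (alg_cost _ _ _).
move: (_ + #|U|) (_ + dKT sigma0 p) (dKT _ _) (minpos _ _).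
move=> c opt d k P P' opt' alg IHs le_d step.
have {step}: 2 * r * (J * k + P') <= 2 * r * (P + c * opt) by rewrite leq_mul2l step orbT.
(* Since [r >= 1], access and move together cost at most [(1 + r) * k <= 2 * r * k]. *)
have {le_d}: J * (k + d) <= J * (2 * r * k) by rewrite leq_mul2l; nia.
nia.
Qed.

Lemma mae_opt_dyn J r pi0 Ss : 0 < r -> {in Ss, forall S, #|S| = r} ->
  J * alg_cost (@move_all_equally U) pi0 Ss <=
  2 * r * (4 * J ^ 2 * #|U| + (J + 4 * J ^ 2 * r + #|U|) * opt_dyn pi0 Ss).
Proof.
move=> r_gt0 Sr; rewrite /opt_dyn; case: arg_minnP => // ps _ _.
apply: leq_trans (mae_cost_le J pi0 pi0 r_gt0 Sr (size_tuple ps)) _.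
by rewrite leq_mul2l leq_add2r potential_le orbT.
Qed.

End Orderings.

(** * Choice of [J] and the real constants *)

(** Take the least [J] with [n <= J ^ 2 * r]. If [J >= 2], then [J <= 2 * (J - 1)] and minimality
    give the factor 4; if [J = 1], use [r <= n]. *)
Lemma sqrt_div_approx n r : 0 < n -> 0 < r -> r <= n ->
  exists2 J, 0 < J & n <= J ^ 2 * r <= 4 * n.
Proof.
move=> n_gt0 r_gt0 le_rn.
have ex : exists J, n <= J ^ 2 * r by exists n; nia.
case: (ex_minnP ex) => J leJ minJ; exists J; first by case: J leJ {minJ}; lia.
rewrite leJ; case: J leJ minJ => [|J] leJ minJ; first by lia.
have: J ^ 2 * r < n by rewrite ltnNge; apply/negP => /minJ; rewrite ltnn.
nia.
Qed.

Local Open Scope ring_scope.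

Lemma powR_3_2 (R : realType) (x : R) :
  0 <= x -> x `^ (3 / 2) = x * Num.sqrt x.
Proof.
move=> x_ge0; rewrite powRrM powR12_sqrt ?powR_ge0 // powR_mulrn //.
by rewrite exprSr sqrtrM ?sqr_ge0 // sqrtr_sqr ger0_norm.
Qed.

Theorem theorem4 (R : realType) :
  exists C : R, forall (n r : nat) (U : finType),
    #|U| = n -> (0 < r)%N ->
    competitive_dyn r (@move_all_equally U)
      (C * (r%:R `^ (3 / 2)) * Num.sqrt n%:R).
Proof.
(* 36 is the factor 2 of [mae_opt_dyn] times the 18 of [coef_le], where 18 = 1 + 4 * 4 + 1. *)
exists 36 => n r U cU r_gt0.
have [lt_nr|le_rn] := ltnP n r.
  (* No set of size [r] exists, so the request sequence is empty. *)
  exists 0 => pi0 [|S Ss] Sr; last first.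
    by have := max_card S; rewrite Sr ?mem_head // cU leqNgt lt_nr.
  by rewrite /alg_cost big_ord0 addr0 !mulr_ge0 ?powR_ge0 ?sqrtr_ge0.
have n_gt0 := leq_trans r_gt0 le_rn.
have [J J_gt0 /andP[lo hi]] := sqrt_div_approx n_gt0 r_gt0 le_rn.
(* The initial potential bound [4 * J ^ 2 * n], times [2 * r], divided by [J]. *)
exists (8 * r * J * n)%:R => pi0 Ss Sr.
have := mae_opt_dyn J pi0 r_gt0 Sr; rewrite cU.
move: (opt_dyn _ _) (alg_cost _ _ _) => opt alg cost_le.
rewrite powR_3_2 //; set s := Num.sqrt r%:R; set q := Num.sqrt n%:R.
have s_ge0 : 0 <= s by apply: sqrtr_ge0.
have q_ge0 : 0 <= q by apply: sqrtr_ge0.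
have ss : s ^+ 2 = r%:R by rewrite sqr_sqrtr.
have qq : q ^+ 2 = n%:R by rewrite sqr_sqrtr.
have s_ge1 : 1 <= s by rewrite -sqrtr1 ler_wsqrtr // ler1n.
have q_ge1 : 1 <= q by rewrite -sqrtr1 ler_wsqrtr // ler1n.
(* Lets [n = q * q] be bounded by [J * s * q], so that [J] cancels at the end. *)
have le_q : q <= J%:R * s.
  rewrite -(@ler_pXn2r _ 2) ?nnegrE ?mulr_ge0 // exprMn ss qq.
  by rewrite -natrX -natrM ler_nat.
have coef_le : (J + 4 * J ^ 2 * r + n)%:R <= 18 * J%:R * (s * q) :> R.
  apply: (@le_trans _ _ (J + 17 * n)%:R); first by rewrite ler_nat; lia.
  rewrite natrD natrM -qq; have J_ge0 : 0 <= J%:R :> R by [].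
  have : q * q <= J%:R * s * q by rewrite ler_wpM2r.
  have : J%:R <= J%:R * (s * q) by rewrite ler_peMr // mulr_ege1.
  by rewrite expr2; lra.
have J0 : 0 < J%:R :> R by rewrite ltr0n.
rewrite -(ler_pM2l J0) -natrM.
apply: (@le_trans _ _ (2 * r * (4 * J ^ 2 * n
                        + (J + 4 * J ^ 2 * r + n) * opt))%:R).
  by rewrite ler_nat.
rewrite natrM natrD (natrM _ (J + _ + n)%N).
have := ler_wpM2l (ler0n R (2 * r)) (ler_wpM2r (ler0n R opt) coef_le).
by rewrite !natrM; lra.
Qed.
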